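(* Let $X$ be a locally compact, non-compact Hausdorff space, with one-point compactification $\alpha X$. Suppose $\alpha X$ is radial. Then every finite compactification of $X$ is radial.
   Context: A transfinite sequence is a net whose domain is (nonempty and) well-ordered. A space $Z$ is radial if for every $z \in Z$ and every $A \subseteq Z$ with $z \in \overline{A}$ there is a transfinite sequence with range in $A$ converging to $z$. A compactification of $X$ is a compact Hausdorff space containing $X$ as a dense subspace; it is finite if its remainder (the complement of $X$ in it) is finite. *)

(* Defs.v *)
From mathcomp Require Import all_boot all_classical.
From mathcomp Require Import topology.

Set Implicit Arguments.
Unset Strict Implicit.
Unset Printing Implicit Defensive.

Local Open Scope classical_set_scope.

(* Convergence of a net along [tails le] says that every neighborhood of the
   limit contains all terms of index above some [i]. *)
Definition tails (I : Type) (le : rel I) : set_system I :=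
  filter_from [set: I] (fun i => [set j | le i j]).

(* [wochoice.well_order] is satisfied by the empty relation on an empty type,
   hence the separate nonemptiness condition. *)
Definition transfinite_domain (I : Type) (le : rel I) : Prop :=
  [set: I] !=set0 /\ wochoice.well_order le.

Definition radial (Z : topologicalType) : Prop :=
  forall (z : Z) (A : set Z), closure A z ->
    exists (I : Type) (le : rel I) (s : I -> Z),
      [/\ transfinite_domain le, range s `<=` A & s @ tails le --> z].

(* [X] is identified with its image under [e] in [K]. *)
Definition topological_embedding (X K : topologicalType) (e : X -> K) : Prop :=
  injective e /\ @open X = @open (initial_topology e).

Definition compactification (X K : topologicalType) (e : X -> K) : Prop :=
  [/\ compact [set: K], hausdorff_space K,
      topological_embedding e & dense (range e)].

Definition finite_compactification (X K : topologicalType) (e : X -> K) : Prop :=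
  compactification e /\ finite_set (~` range e).

(* Main.v *)
Require Import Defs.
From mathcomp Require Import all_boot all_classical.
From mathcomp Require Import topology.

Local Open Scope classical_set_scope.

(** The map from the finite compactification [K] onto the one-point
    compactification that fixes [X] and sends the remainder to infinity is
    continuous with finite fibers, and radiality lifts along any such map [f]
    between compact Hausdorff spaces. Indeed, if [z] is in the closure of [A],
    choose a neighborhood [U] of [z] whose closure meets the fiber of [z] in
    [z] only. A transfinite sequence in [f (A `&` U)] converging to [f z]
    lifts to [A `&` U], and every lift converges to [z]: for an open [V]
    containing [z], the closed set [f (closure U `\` V)] misses [f z]. *)

Lemma closed_image_compact (K Y : topologicalType) (f : K -> Y) (C : set K) :
  compact [set: K] -> hausdorff_space Y -> continuous f ->
  closed C -> closed (f @` C).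
Proof.
move=> cptK hY cf clC; apply: compact_closed => //.
apply: continuous_compact; first exact: continuous_subspaceT.
exact: subclosed_compact clC cptK _.
Qed.

Lemma radial_finite_fibers (K Y : topologicalType) (f : K -> Y) :
  compact [set: K] -> hausdorff_space K -> hausdorff_space Y ->
  continuous f -> (forall y, finite_set (f @^-1` [set y])) ->
  radial Y -> radial K.
Proof.
move=> cptK hK hY cf finf radY z A Az.
pose F := f @^-1` [set f z] `\ z.
have clF : closed F.
  apply: (accessible_finite_set_closed.1 (hausdorff_accessible hK)).
  by apply: sub_finite_set (finf (f z)) => k [].
have nF : nbhs z (~` F).
  by apply: open_nbhs_nbhs; split; [exact: closed_openC | by move=> [_]; apply].
have [U Uz UF] := compact_regular hK cptK filterT nF.
have fAz : closure (f @` (A `&` U)) (f z).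
  move=> N fzN; have fN : nbhs z (f @^-1` N) by exact: cf.
  have [k [Ak [Nk Uk]]] := Az _ (filterI fN Uz).
  by exists (f k); split => //; exists k.
have [I [le [s [dom sA sz]]]] := radY _ _ fAz.
have /choice[a aP] : forall i, exists k, (A `&` U) k /\ f k = s i.
  by move=> i; have [k Ak fk] := sA _ (imageT s i); exists k.
exists I, le, a; split => //; first by move=> _ [i _ <-]; case: (aP i) => -[].
(* [V] need not be open; removing its interior makes [C] the image of a closed set. *)
move=> V Vz; pose C := f @` (closure U `\` V°).
have clC : closed C.
  apply: closed_image_compact => //; apply: closedI; first exact: closed_closure.
  by apply: open_closedC; exact: open_interior.
have nC : nbhs (f z) (~` C).
  apply: open_nbhs_nbhs; split; first exact: closed_openC.
  (* A point of [closure U] over [f z] avoids [F], so it is [z] itself, which lies in the interior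
     of [V]. *)
  move=> [k [Uk nVk] fk]; apply: (UF _ Uk); split=> // kz.
  by apply: nVk; rewrite kz.
have [i _ siC] := sz _ nC; exists i => // j leij.
have [[_ Uj] fj] := aP j; apply: interior_subset; apply: contrapT => nVj.
apply: (siC j leij); exists (a j) => //.
by split=> //; exact: subset_closure.
Qed.

(** Points of [one_point_compactification X] are those of [option X], with [None] as infinity. The
    preimage is picked by choice, hence canonical once [e] is injective. *)
Definition collapse {X K : Type} (e : X -> K) (k : K) :
    one_point_compactification X :=
  if pselect (range e k) is left ek then Some (s2val (cid2 ek)) else None.

Lemma collapse_image {X K : Type} (e : X -> K) (x : X) :
  injective e -> collapse e (e x) = Some x.
Proof.
move=> inje; rewrite /collapse; case: pselect => [ex|[]]; last by exists x.
by case: cid2 => /= y _ /inje ->.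
Qed.

Lemma collapse_Some {X K : Type} {e : X -> K} {k : K} {x : X} :
  collapse e k = Some x -> e x = k.
Proof. by rewrite /collapse; case: pselect => // ek [<-]; case: cid2. Qed.

Lemma collapse_None {X K : Type} {e : X -> K} {k : K} :
  collapse e k = None -> ~ range e k.
Proof. by rewrite /collapse; case: pselect. Qed.

Lemma topological_embedding_continuous (X K : topologicalType) (e : X -> K) :
  topological_embedding e -> continuous e.
Proof. by move=> [_ opE]; apply/continuousP => O oO; rewrite opE; exists O. Qed.

(** At points of [range e], its openness makes images of open sets of [X] open in [K]. At the
    remainder, a basic neighborhood of infinity omits a compact [C], whose image under [e] is
    compact, hence closed in [K]. *)
Lemma collapse_continuous (X K : topologicalType) (e : X -> K) :
  hausdorff_space K -> topological_embedding e -> open (range e) ->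
  continuous (collapse e).
Proof.
move=> hK emb oe k; have [inje opE] := emb.
case ek: (collapse e k) => [x|] N.
  rewrite ek => Nx; have : nbhs x (Some @^-1` N) by [].
  rewrite nbhsE => -[W [+ Wx] WN]; rewrite opE => -[O oO OW].
  have <- := collapse_Some ek.
  have nO : nbhs (e x) (O `&` range e).
    apply: open_nbhs_nbhs; split; first exact: openI.
    by split; [rewrite -OW in Wx | exists x].
  apply: filterS nO => _ [/[swap] -[y _ <-] Oy].
  by rewrite /= collapse_image//; apply: WN; rewrite -OW.
rewrite ek => -[C [cptC _] CN].
have nC : nbhs k (~` (e @` C)).
  apply: open_nbhs_nbhs; split.
    apply: closed_openC; apply: compact_closed => //.
    apply: continuous_compact => //; apply: continuous_subspaceT.
    exact: topological_embedding_continuous.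
  by move=> [x _ xk]; apply: (collapse_None ek); exists x.
apply: filterS nC => y nCy; apply: CN.
case ey: (collapse e y) => [x|]; [left | by right].
exists x => // Cx; apply: nCy; exists x => //; exact: collapse_Some ey.
Qed.

Lemma collapse_finite_fibers {X K : Type} (e : X -> K) :
  finite_set (~` range e) ->
  forall y, finite_set (collapse e @^-1` [set y]).
Proof.
move=> fine [x|].
- by apply: (@sub_finite_set _ _ [set e x]) => // k /= /collapse_Some.
- by apply: sub_finite_set fine => k /= /collapse_None.
Qed.

Theorem corollary3p3 (X : topologicalType) :
  hausdorff_space X ->
  locally_compact [set: X] ->
  ~ compact [set: X] ->
  radial (one_point_compactification X) ->
  forall (K : topologicalType) (e : X -> K),
    finite_compactification e -> radial K.
Proof.
move=> hX lcX _ radX K e [[cptK hK emb _] fine].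
(* The remainder is finite, hence closed in the Hausdorff space [K]. *)
have oe : open (range e).
  rewrite -[range e]setCK; apply: closed_openC.
  exact: (accessible_finite_set_closed.1 (hausdorff_accessible hK)).
apply: (radial_finite_fibers _ _ (collapse e)) => //.
(* Local compactness separates the points of [X] from infinity. *)
- exact: one_point_compactification_hausdorff.
- exact: collapse_continuous.
- exact: collapse_finite_fibers.
Qed.
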